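(* Let $J$ be a finite set with $n=|J|\ge2$, let $E$ be a partition of $J$ into pairs, and let $F:\{0,1\}^J\to\mathbb{Q}_{\ge0}$ be even-windable. For $k\ge0$ let $\Omega_k$ be the set of $k$-assignments $x$ (with respect to $E$) with $F(x)>0$, let $\Omega=\Omega_0\cup\Omega_2$, and assume $\Omega_0\neq\emptyset$. Define $P:\Omega\times\Omega\to[0,1]$ by $P(x,y)=\frac{2}{n^2}\min(1,F(y)/F(x))$ if $d(x,y)=2$, $P(x,x)=1-\frac2{n^2}\sum_{y'\in\Omega:d(x,y')=2}\min(1,F(y')/F(x))$, and $P(x,y)=0$ otherwise. Let $\pi(x)=F(x)/\sum_{y\in\Omega}F(y)$ for $x\in\Omega$ and $\pi(\Omega_0)=\sum_{x\in\Omega_0}\pi(x)$. Then for all $x\in\Omega$ and all integers $t\ge0$, $$\tfrac12\sum_{y\in\Omega}|P^t(x,y)-\pi(y)|\le\tfrac12\pi(x)^{-1/2}\exp\!\left(-t\,\pi(\Omega_0)^2/n^4\right),$$ where $P^t$ is the $t$-th matrix power.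
   Context: For $x,y\in\{0,1\}^J$, $x\oplus y$ is coordinatewise addition mod 2, $d(x,y)=|\{i:x_i\ne y_i\}|$, and $\mathbf S$ is the characteristic vector of $S\subseteq J$. For a partition $E$ of $J$ into pairs, a $k$-assignment is a configuration $x\in\{0,1\}^J$ such that $x_i\ne x_j$ for exactly $k$ pairs $\{i,j\}\in E$. For $z\in\{0,1\}^J$, $\mathrm{Match}(z)$ is the set of partitions of $\{i:z_i=1\}$ into pairs (empty if $\sum z_i$ is odd). $F:\{0,1\}^J\to\mathbb{Q}_{\ge0}$ is even-windable if there exist $B(x,y,M)\ge0$ for all $x,y\in\{0,1\}^J$, $M\in\mathrm{Match}(x\oplus y)$, with (EW1) $F(x)F(y)=\sum_{M\in\mathrm{Match}(x\oplus y)}B(x,y,M)$ for all $x,y$, and (EW2) $B(x,y,M)=B(x\oplus\mathbf S,y\oplus\mathbf S,M)$ for all $x,y$ and all $S\in M\in\mathrm{Match}(x\oplus y)$. *)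

(* Defs.v *)
From Stdlib Require Import QArith Qreals Reals.
From mathcomp Require Import all_boot.
Local Open Scope nat_scope.
Set Implicit Arguments. Unset Strict Implicit. Unset Printing Implicit Defensive.

Section Defs.
Variable J : finType.

Definition config := {ffun J -> bool}.

Definition cxor (x y : config) : config := [ffun i => x i (+) y i].

Definition cflip (x : config) (S : {set J}) : config := [ffun i => x i (+) (i \in S)].

Definition hdist (x y : config) : nat := #|[set i | x i != y i]|.

Definition pair_partition (E : {set {set J}}) : bool :=
  partition E [set: J] && [forall e in E, #|e| == 2].

Definition Match (z : config) : {set {set {set J}}} :=
  [set M : {set {set J}} | partition M [set i | z i] && [forall e in M, #|e| == 2]].

Definition pair_split (x : config) (e : {set J}) : bool :=
  [exists i in e, exists j in e, x i != x j].

Definition kassign (E : {set {set J}}) (k : nat) (x : config) : bool :=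
  #|[set e in E | pair_split x e]| == k.

Definition even_windable (F : config -> Q) : Prop :=
  exists B : config -> config -> {set {set J}} -> Q,
    (forall x y M, M \in Match (cxor x y) -> Qle 0 (B x y M)) /\
    (forall x y, Qeq (F x * F y)%Q (\big[Qplus/0%Q]_(M in Match (cxor x y)) B x y M)) /\
    (forall x y M S, M \in Match (cxor x y) -> S \in M ->
        Qeq (B x y M) (B (cflip x S) (cflip y S) M)).

Definition posQ (q : Q) : bool := ~~ Qle_bool q 0.

Definition Omega_k (E : {set {set J}}) (F : config -> Q) (k : nat) : {set config} :=
  [set x | kassign E k x && posQ (F x)].

Definition Omega (E : {set {set J}}) (F : config -> Q) : {set config} :=
  Omega_k E F 0 :|: Omega_k E F 2.

Definition FR (F : config -> Q) (x : config) : R := Q2R (F x).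

(* the transition matrix P on Omega (entries for x, y in Omega) *)
Definition Pmat (E : {set {set J}}) (F : config -> Q) (x y : config) : R :=
  let c := Rdiv (IZR 2) (pow (INR #|J|) 2) in
  if x == y then
    Rminus R1 (Rmult c
       (\big[Rplus/R0]_(y' in Omega E F | hdist x y' == 2)
          Rmin R1 (Rdiv (FR F y') (FR F x))))
  else if hdist x y == 2 then
    Rmult c (Rmin R1 (Rdiv (FR F y) (FR F x)))
  else R0.

Fixpoint Ppow (E : {set {set J}}) (F : config -> Q) (t : nat) (x y : config) : R :=
  match t with
  | O => if x == y then R1 else R0
  | S t' => \big[Rplus/R0]_(z in Omega E F) Rmult (Ppow E F t' x z) (Pmat E F z y)
  end.

Definition piR (E : {set {set J}}) (F : config -> Q) (x : config) : R :=
  Rdiv (FR F x) (\big[Rplus/R0]_(y in Omega E F) FR F y).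

Definition piOmega0 (E : {set {set J}}) (F : config -> Q) : R :=
  \big[Rplus/R0]_(x in Omega_k E F 0) piR E F x.

End Defs.

(* Main.v *)
(* By reversibility, the L2 norm of P^t(x,.)/pi - 1 shrinks by 1 - c at each
   step, where c is a Poincare constant of P (holding probabilities at least
   1/n take care of the negative part of the spectrum).  To bound c, send
   B(x,y,M) units of flow from each x in Omega to each y in Omega_0, along the
   path that flips the pairs of M one at a time, in an order that keeps at most
   two pairs of E split.  By (EW2) the weight of a path is B(z,z',M) at each
   intermediate z, with z' the complementary configuration, which has at most
   four split pairs; hence the flow through an edge {z,w} is at most
   min(pi z, pi w) pi(Omega_0 + Omega_2 + Omega_4).  Winding half of a matching
   between Omega_4 and Omega_0 gives pi(Omega_4) pi(Omega_0) <= pi(Omega_2)^2,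
   so this last factor is at most 1 / pi(Omega_0). *)
Require Import Defs.
From Stdlib Require Import QArith Qreals Reals.
From mathcomp Require Import all_boot all_order all_algebra.
From mathcomp Require Import zify ring lra.
From mathcomp Require Import Rstruct.
Set Implicit Arguments. Unset Strict Implicit. Unset Printing Implicit Defensive.
Import Order.TTheory GRing.Theory Num.Theory.
Local Open Scope nat_scope.

(** * Symmetric differences *)

Section SymmetricDifference.
Variables (K : eqType) (L : finType).

Definition symdiff (A B : {set L}) := [set e | (e \in A) (+) (e \in B)].

Lemma card_symdiff (A B : {set L}) :
  #|symdiff A B| + 2 * #|A :&: B| = #|A| + #|B|.
Proof.
have -> : symdiff A B = (A :\: B) :|: (B :\: A).
  by apply/setP=> e; rewrite !inE; case: (e \in A); case: (e \in B).
rewrite cardsU.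
have -> : (A :\: B) :&: (B :\: A) = set0.
  by apply/setP=> e; rewrite !inE; case: (e \in A); case: (e \in B).
have := cardsID B A; have := cardsID A B; rewrite cards0 [B :&: A]setIC; lia.
Qed.

Variable d : K -> {set L}.

(** Will be used with [d S] the pairs of [E] split by the indicator of [S]. If each [d S] is viewed
    as an edge, these are the vertices of odd degree. *)
Definition symdiffs (s : seq K) := [set e | \big[addb/false]_(S <- s) (e \in d S)].

Lemma symdiffs_cons S s : symdiffs (S :: s) = symdiff (d S) (symdiffs s).
Proof. by apply/setP=> e; rewrite !inE big_cons. Qed.

Lemma symdiffs_cat s1 s2 :
  symdiffs (s1 ++ s2) = symdiff (symdiffs s1) (symdiffs s2).
Proof. by apply/setP=> e; rewrite !inE big_cat. Qed.

Lemma symdiffs_nil : symdiffs [::] = set0.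
Proof. by apply/setP=> e; rewrite !inE big_nil. Qed.

Lemma symdiffs1 S : symdiffs [:: S] = d S.
Proof. by apply/setP=> e; rewrite !inE big_seq1. Qed.

Lemma perm_symdiffs s1 s2 : perm_eq s1 s2 -> symdiffs s1 = symdiffs s2.
Proof. by move=> s12; apply/setP=> e; rewrite !inE (perm_big s2). Qed.

Lemma mem_symdiffs e s : e \in symdiffs s -> exists2 S, S \in s & e \in d S.
Proof.
elim: s => [|S s IH]; first by rewrite symdiffs_nil inE.
rewrite symdiffs_cons inE; case: (boolP (e \in d S)) => [eS _|_ /IH[S' S's eS']].
  by exists S; rewrite ?mem_head.
by exists S'; rewrite // inE S's orbT.
Qed.

Lemma symdiffs_even s :
  {in s, forall S, ~~ odd #|d S|} -> ~~ odd #|symdiffs s|.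
Proof.
elim: s => [|S s IH] dE; first by rewrite symdiffs_nil cards0.
rewrite symdiffs_cons.
have /IH : {in s, forall S', ~~ odd #|d S'|}.
  by move=> S' S's; apply: dE; rewrite inE S's orbT.
have := dE S (mem_head _ _); have := card_symdiff (d S) (symdiffs s); lia.
Qed.

(* Greedily remove an element [S] whose [d S] meets the current symmetric
   difference: this never increases its size. *)
Lemma symdiffs_order s :
  {in s, forall S, #|d S| <= 2} -> #|symdiffs s| <= 2 ->
  exists2 s', perm_eq s s' & forall k, #|symdiffs (drop k s')| <= 2.
Proof.
elim: {s}(size s) {-2}s (erefl (size s)) => [|m IH] s sz d2 s2.
  by exists s => // k; rewrite (size0nil sz) /= symdiffs_nil cards0.
have [S Ss le2] : exists2 S, S \in s & #|symdiffs (rem S s)| <= 2.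
  have step S : S \in s -> symdiffs s = symdiff (d S) (symdiffs (rem S s)).
    by move=> Ss; rewrite -symdiffs_cons; apply: perm_symdiffs (perm_to_rem Ss).
  have back S : S \in s -> symdiffs (rem S s) = symdiff (d S) (symdiffs s).
    move=> Ss; apply/setP=> e; rewrite (step S Ss) !inE.
    by case: (e \in d S); case: (\big[_/_]_(_ <- _) _).
  (* If the difference is empty, any [S] can go first: the rest then has difference [d S], of size
     at most 2. *)
  have [s0|[e es]] := set_0Vmem (symdiffs s).
    case: s {IH s2 step} sz d2 back s0 => // S s _ d2 back s0.
    exists S; first exact: mem_head.
    rewrite back ?mem_head //; have := d2 S (mem_head _ _).
    have := card_symdiff (d S) (symdiffs (S :: s)); rewrite s0 cards0; lia.
  have [S Ss eS] := mem_symdiffs es; exists S => //; rewrite back //.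
  have := card_symdiff (d S) (symdiffs s); have := d2 S Ss.
  have : 0 < #|d S :&: symdiffs s| by apply/card_gt0P; exists e; rewrite inE eS.
  lia.
have [] := IH (rem S s) _ _ le2.
- by rewrite size_rem // sz.
- by move=> S' /mem_rem; apply: d2.
move=> s' ss' s'2; exists (S :: s').
  by rewrite (perm_trans (perm_to_rem Ss)) // perm_cons.
case=> [|k] /=; last exact: s'2.
by rewrite -(@perm_symdiffs s) // (perm_trans (perm_to_rem Ss)) ?perm_cons.
Qed.

(** Four vertices of odd degree are separated two by two by peeling off an edge [d S] = {e, f} with
    [e] odd. If [f] is odd too, [S] alone is one half. Otherwise, in the rest, [f] takes the place
    of [e]; split the rest by induction and add [S] to the half where [f] is odd, which moves [f]
    back to [e]. *)
Lemma symdiffs_split s :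
  {in s, forall S, #|d S| <= 2} -> {in s, forall S, ~~ odd #|d S|} ->
  #|symdiffs s| = 4 ->
  exists s1 s2, [/\ perm_eq s (s1 ++ s2), #|symdiffs s1| = 2 & #|symdiffs s2| = 2].
Proof.
elim: {s}(size s) {-2}s (erefl (size s)) => [|m IH] s sz d2 dE s4.
  by move: s4; rewrite (size0nil sz) symdiffs_nil cards0.
have [e es] : exists e, e \in symdiffs s by apply/card_gt0P; rewrite s4.
have [S Ss eS] := mem_symdiffs es.
have sE : symdiffs s = symdiff (d S) (symdiffs (rem S s)).
  by rewrite -symdiffs_cons; apply: perm_symdiffs (perm_to_rem Ss).
have rE : symdiffs (rem S s) = symdiff (d S) (symdiffs s).
  apply/setP=> e'; rewrite sE !inE.
  by case: (e' \in d S); case: (\big[_/_]_(_ <- _) _).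
have I0 : 0 < #|d S :&: symdiffs s| by apply/card_gt0P; exists e; rewrite inE eS.
have dS0 : 0 < #|d S| by apply/card_gt0P; exists e.
have dS2 : #|d S| = 2 by have := d2 S Ss; have := dE S Ss; lia.
have I2 : #|d S :&: symdiffs s| <= 2 by rewrite -dS2 subset_leq_card ?subsetIl.
have cE := card_symdiff (d S) (symdiffs s).
case: (leqP 2 #|d S :&: symdiffs s|) => I1.
  exists [:: S], (rem S s); rewrite symdiffs1 rE; split=> //; last by lia.
  exact: perm_to_rem.
have r4 : #|symdiffs (rem S s)| = 4 by rewrite rE; lia.
have [f fS fs] : exists2 f, f \in d S & f \notin symdiffs s.
  have /subsetPn[f fS fs] : ~~ (d S \subset symdiffs s).
    by apply: contraL I1 => /setIidPl ->; rewrite dS2.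
  by exists f.
have [|||s1 [s2 [r12 c1 c2]]] := IH (rem S s) _ _ _ r4.
- by rewrite size_rem // sz.
- by move=> S' /mem_rem; apply: d2.
- by move=> S' /mem_rem; apply: dE.
have fr : f \in symdiffs (rem S s) by rewrite rE inE fS (negPf fs).
have er : e \notin symdiffs (rem S s) by rewrite rE inE eS es.
have sS := perm_trans (perm_to_rem Ss).
(* [f] is odd in one of the two halves, whose roles are symmetric. *)
wlog f1 : s1 s2 r12 c1 c2 / f \in symdiffs s1 => [wl|].
  have := fr; rewrite (perm_symdiffs r12) symdiffs_cat inE.
  case: (boolP (f \in symdiffs s1)) => [f1 _|_ /= f2]; first exact: (wl s1 s2).
  by apply: (wl s2 s1) => //; rewrite (perm_trans r12) // perm_catC.
exists (S :: s1), s2; split=> //.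
  by rewrite sS //= perm_cons.
have rE' : symdiffs (rem S s) = symdiff (symdiffs s1) (symdiffs s2).
  by rewrite (perm_symdiffs r12) symdiffs_cat.
(* Two differences of size 2 whose symmetric difference has size 4 are disjoint, so [e] in the first
   one would survive in the rest. *)
have e1 : e \notin symdiffs s1.
  apply: contra er => e1; rewrite rE' inE e1 /=; apply/negP=> e2.
  have : 0 < #|symdiffs s1 :&: symdiffs s2|.
    by apply/card_gt0P; exists e; rewrite inE e1.
  have := card_symdiff (symdiffs s1) (symdiffs s2); rewrite -rE'; lia.
rewrite symdiffs_cons; have := card_symdiff (d S) (symdiffs s1).
have : 0 < #|d S :&: symdiffs s1| by apply/card_gt0P; exists f; rewrite inE fS.
have : #|d S :&: symdiffs s1| < 2.
  rewrite -dS2; apply: proper_card; rewrite properE subsetIl.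
  by apply/subsetPn; exists e; rewrite // inE eS (negPf e1).
lia.
Qed.

End SymmetricDifference.

(** * Split pairs and matchings *)

Section Splits.
Variables (J : finType) (E : {set {set J}}).
Local Notation config := (config J).

(** Parity instead of membership in the union makes concatenation correspond to [cxor] without any
    disjointness condition. *)
Definition indic (s : seq {set J}) : config :=
  [ffun i => \big[addb/false]_(S <- s) (i \in S)].

Definition splits (x : config) := [set e in E | pair_split x e].

Lemma cxorK c : involutive ((@cxor J)^~ c).
Proof. by move=> x; apply/ffunP=> i; rewrite !ffunE addbK. Qed.

Lemma cxorxx (x : config) : cxor x x = indic [::].
Proof. by apply/ffunP=> i; rewrite !ffunE big_nil addbb. Qed.

Lemma cxor0 (x : config) : cxor x (indic [::]) = x.
Proof. by apply/ffunP=> i; rewrite !ffunE big_nil addbF. Qed.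

Lemma cxorA : associative (@cxor J).
Proof. by move=> x y z; apply/ffunP=> i; rewrite !ffunE addbA. Qed.

Lemma cxorC : commutative (@cxor J).
Proof. by move=> x y; apply/ffunP=> i; rewrite !ffunE addbC. Qed.

Lemma indic_cat s1 s2 : indic (s1 ++ s2) = cxor (indic s1) (indic s2).
Proof. by apply/ffunP=> i; rewrite !ffunE big_cat. Qed.

Lemma perm_indic s1 s2 : perm_eq s1 s2 -> indic s1 = indic s2.
Proof. by move=> s12; apply/ffunP=> i; rewrite !ffunE (perm_big s2). Qed.

Lemma cxor_cons x S s : cxor x (indic (S :: s)) = cflip (cxor x (indic s)) S.
Proof.
by apply/ffunP=> i; rewrite !ffunE big_cons -addbA [(i \in S) (+) _]addbC.
Qed.

Lemma cflipE x S : cflip x S = cxor x (indic [:: S]).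
Proof. by rewrite cxor_cons cxor0. Qed.

Lemma cflipK S : involutive ((@cflip J)^~ S).
Proof. by move=> x; rewrite !cflipE cxorK. Qed.

Lemma hdist_cflip x (S : {set J}) : hdist x (cflip x S) = #|S|.
Proof.
by apply: eq_card => i; rewrite !inE ffunE; case: (x i); case: (i \in S).
Qed.

Lemma hdistxx (x : config) : hdist x x = 0.
Proof. by apply: eq_card0 => i; rewrite !inE eqxx. Qed.

Lemma hdistC (x y : config) : hdist x y = hdist y x.
Proof. by apply: eq_card => i; rewrite !inE eq_sym. Qed.

Lemma Match_card2 (z : config) M : M \in Match z -> {in M, forall S : {set J}, #|S| = 2}.
Proof. by rewrite inE => /andP[_ /forall_inP M2] S /M2/eqP. Qed.

Lemma Match_indic (z : config) M : M \in Match z -> indic (enum M) = z.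
Proof.
rewrite inE => /andP[/and3P[/eqP covM triM _] _]; apply/ffunP=> i.
rewrite ffunE big_enum /=.
have -> : z i = (i \in cover M) by rewrite covM inE.
have [iM|iM] := boolP (i \in cover M).
  rewrite (bigD1 (pblock M i)) ?pblock_mem //= mem_pblock iM.
  rewrite big1 // => S /andP[SM neS]; apply/negbTE; apply: contra neS => iS.
  by rewrite (def_pblock triM SM iS).
rewrite big1 // => S SM; apply/negbTE; apply: contra iM => iS.
by apply/bigcupP; exists S.
Qed.

(** Bounds the length of a winding path. The pairs of [M] cover 2|M| indices; the factor 2 is given
    away. *)
Lemma Match_size (z : config) M : M \in Match z -> #|M| <= #|J|.
Proof.
rewrite inE => /andP[/card_partition cM /forall_inP M2].
apply: leq_trans (max_card [set i | z i]); rewrite {}cM -sum1_card.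
by apply: leq_sum => S /M2/eqP->.
Qed.

Hypothesis hE : pair_partition E.

Let E2 e : e \in E -> #|e| = 2.
Proof. by case/andP: hE => _ /forall_inP E2 /E2/eqP. Qed.

(** Being split is linear over the field with two elements, which makes [splits] additive. *)
Lemma pair_splitE (x : config) (e : {set J}) :
  #|e| = 2 -> pair_split x e = \big[addb/false]_(i in e) x i.
Proof.
move=> /eqP/cards2P[i] [j] [ij ->]; rewrite big_setU1 ?inE //= big_set1.
apply/idP/idP => [/exists_inP[k + /exists_inP[l]]|xij].
  by rewrite !inE => /orP[]/eqP-> /orP[]/eqP->; case: (x i); case: (x j).
apply/exists_inP; exists i; first by rewrite !inE eqxx.
apply/exists_inP; exists j; first by rewrite !inE eqxx orbT.
by move: xij; case: (x i); case: (x j).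
Qed.

Lemma splits_xor x y : splits (cxor x y) = symdiff (splits x) (splits y).
Proof.
apply/setP=> e; rewrite !inE; case eE: (e \in E) => //=.
rewrite !pair_splitE ?E2 // -big_split; apply: eq_bigr => i _.
by rewrite ffunE.
Qed.

Lemma splits_indic s :
  splits (indic s) = symdiffs (fun S => splits (indic [:: S])) s.
Proof.
elim: s => [|S s IH]; last by rewrite symdiffs_cons -IH -splits_xor -indic_cat.
rewrite symdiffs_nil; apply/setP=> e; rewrite !inE; apply/negP=> /andP[_].
by case/exists_inP=> i _ /exists_inP[j _]; rewrite !ffunE !big_nil.
Qed.

(** A split pair contains a point of [S], hence is the block of [E] at that point. *)
Lemma card_splits_indic1 (S : {set J}) : #|splits (indic [:: S])| <= #|S|.
Proof.
apply: leq_trans (leq_imset_card (pblock E) S); apply: subset_leq_card.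
apply/subsetP=> e; rewrite inE => /andP[eE /exists_inP[i ie /exists_inP[j je]]].
case/andP: hE => /and3P[_ triE _] _.
rewrite !ffunE !big_seq1; case: (boolP (i \in S)) => iS; last first.
  case: (boolP (j \in S)) => // jS _; apply/imsetP; exists j => //.
  by rewrite (def_pblock triE eE je).
by move=> _; apply/imsetP; exists i; rewrite // (def_pblock triE eE ie).
Qed.

Lemma odd_card (T : finType) (A : {set T}) :
  odd #|A| = \big[addb/false]_(i in A) true.
Proof. by rewrite -sum1_card (big_morph odd oddD (erefl _)). Qed.

(** A pair is split when its two bits have odd sum; adding over the blocks of [E] gives the parity
    of all bits of [x]. *)
Lemma odd_splits x : odd #|splits x| = \big[addb/false]_i x i.
Proof.
case/andP: hE => /and3P[/eqP covE triE _] _.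
transitivity (\big[addb/false]_(e in E) \big[addb/false]_(i in e) x i); last first.
  by rewrite -big_trivIset // covE; apply: eq_bigl => i; rewrite inE.
rewrite odd_card big_mkcond [RHS]big_mkcond; apply: eq_bigr => e _.
by rewrite inE; case eE: (e \in E) => //=; rewrite -pair_splitE ?E2 //; case: ifP.
Qed.

Lemma splits_indic1_even (S : {set J}) : #|S| = 2 -> ~~ odd #|splits (indic [:: S])|.
Proof.
move=> S2; rewrite odd_splits; suff -> : \big[addb/false]_i indic [:: S] i = odd #|S|.
  by rewrite S2.
rewrite odd_card [RHS]big_mkcond; apply: eq_bigr => i _.
by rewrite ffunE big_seq1; case: ifP.
Qed.

Lemma splits_xor0 x y : #|splits y| = 0 -> splits (cxor x y) = splits x.
Proof.
move/eqP; rewrite cards_eq0 splits_xor => /eqP->; apply/setP=> e.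
by rewrite !inE addbF.
Qed.

Lemma splits_indic_even s :
  {in s, forall S : {set J}, #|S| = 2} -> ~~ odd #|splits (indic s)|.
Proof.
move=> s2; rewrite splits_indic; apply: symdiffs_even => S /s2.
exact: splits_indic1_even.
Qed.

(* The order [s] depends on [M] alone: a path x -> y then has its endpoints
   determined by one of its steps, the complementary configuration and [M]. *)
Lemma winding_order (M : {set {set J}}) : exists s, forall x y : config,
  M \in Match (cxor x y) -> #|splits x| <= 2 -> #|splits y| = 0 ->
  perm_eq (enum M) s /\ forall k, #|splits (indic (drop k s))| <= 2.
Proof.
(* Since [y] splits no pair, [x] splits the same pairs as [cxor x y], the indicator of [M]. The
   hypothesis on [x] is thus a condition on [M] alone, which can be tested before [x] and [y] are
   given. *)
have [/andP[/forall_inP M2 D2]|nM] :=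
    boolP ([forall S in M, #|S| == 2] && (#|splits (indic (enum M))| <= 2)).
  have [||s Ms sk] := @symdiffs_order _ _ (fun S => splits (indic [:: S])) (enum M).
  - move=> S; rewrite mem_enum => /M2/eqP S2; rewrite -S2.
    exact: card_splits_indic1.
  - by rewrite -splits_indic.
  by exists s => x y _ _ _; split=> // k; rewrite splits_indic.
(* Dummy order for an [M] that matches no admissible [x] and [y]. *)
exists [::] => x y MM x2 y0; case/negP: nM.
rewrite (Match_indic MM) splits_xor0 // x2 andbT.
by apply/forall_inP=> S SM; apply/eqP; apply: (Match_card2 MM).
Qed.

(** Half of the matching, cut by [symdiffs_split]. It is chosen from [M] alone, so that for fixed
    [M] flipping it permutes the pairs (x, y). *)
Lemma winding_split (M : {set {set J}}) : exists s, forall x y : config,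
  M \in Match (cxor x y) -> #|splits x| = 4 -> #|splits y| = 0 ->
  [/\ {subset s <= M}, #|splits (cxor x (indic s))| = 2
    & #|splits (cxor y (indic s))| = 2].
Proof.
have [/andP[/forall_inP M2 /eqP D4]|nM] :=
    boolP ([forall S in M, #|S| == 2] && (#|splits (indic (enum M))| == 4)).
  have [|||s1 [s2 [Ms c1 c2]]] :=
      @symdiffs_split _ _ (fun S => splits (indic [:: S])) (enum M).
  - move=> S; rewrite mem_enum => /M2/eqP S2; rewrite -S2.
    exact: card_splits_indic1.
  - by move=> S; rewrite mem_enum => /M2/eqP; apply: splits_indic1_even.
  - by rewrite -splits_indic.
  exists s1 => x y MM _ y0; split.
  - by move=> S S1; rewrite -mem_enum (perm_mem Ms) mem_cat S1.
  (* Flipping [s1] from [x] is the same as flipping the other half from [y], because the two halves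
     together lead from [x] to [y]. *)
  - have -> : cxor x (indic s1) = cxor (indic s2) y.
      have := Match_indic MM; rewrite (perm_indic Ms) indic_cat => xyE.
      have -> : x = cxor (cxor x y) y by rewrite cxorK.
      by rewrite -xyE cxorC -!cxorA !cxorA cxorxx [cxor (indic [::]) _]cxorC cxor0.
    by rewrite splits_xor0 // splits_indic.
  by rewrite cxorC splits_xor0 // splits_indic.
exists [::] => x y MM x2 y0; case/negP: nM.
rewrite (Match_indic MM) splits_xor0 // x2 eqxx andbT.
by apply/forall_inP=> S SM; apply/eqP; apply: (Match_card2 MM).
Qed.

End Splits.

Local Open Scope ring_scope.

(** * Reversible Markov chains *)

Section ReversibleChain.
Variables (R : realFieldType) (T : finType) (A : {set T}).
Variables (p : T -> R) (P : T -> T -> R).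

Fixpoint kernel_pow t x y : R :=
  if t is t'.+1 then \sum_(z in A) kernel_pow t' x z * P z y else (x == y)%:R.

Hypothesis p_gt0 : forall x, x \in A -> 0 < p x.
Hypothesis p_sum1 : \sum_(x in A) p x = 1.
Hypothesis P_ge0 : forall x y, x \in A -> y \in A -> 0 <= P x y.
Hypothesis P_sum1 : forall x, x \in A -> \sum_(y in A) P x y = 1.
Hypothesis P_rev : forall x y, x \in A -> y \in A -> p x * P x y = p y * P y x.

(** The inner product of L2(p) on [A]; [op] below is the action of [P] on functions, self-adjoint by
    reversibility. *)
Let ip (f g : T -> R) := \sum_(x in A) p x * f x * g x.
Let op (f : T -> R) x := \sum_(y in A) P x y * f y.

Let ipC f g : ip f g = ip g f.
Proof. by apply: eq_bigr => x _; rewrite mulrAC. Qed.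

Let ip_opE f g :
  ip f (op g) = \sum_(x in A) \sum_(y in A) p x * P x y * (f x * g y).
Proof.
apply: eq_bigr => x _; rewrite mulr_sumr; apply: eq_bigr => y _; ring.
Qed.

Let ip_op_sym f g : ip f (op g) = ip g (op f).
Proof.
rewrite !ip_opE exchange_big; apply: eq_bigr => x xA; apply: eq_bigr => y yA.
by rewrite (P_rev yA xA) [f y * _]mulrC.
Qed.

Let sum_left f : \sum_(x in A) \sum_(y in A) p x * P x y * f x ^+ 2 = ip f f.
Proof.
apply: eq_bigr => x xA; rewrite -mulr_suml -mulr_sumr P_sum1 //; ring.
Qed.

Let sum_right f : \sum_(x in A) \sum_(y in A) p x * P x y * f y ^+ 2 = ip f f.
Proof.
rewrite exchange_big -sum_left; apply: eq_bigr => x xA; apply: eq_bigr => y yA.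
by rewrite (P_rev yA xA).
Qed.

(** The left side is twice the Dirichlet form, the quadratic form of 1 - P. *)
Let sum_sqrB f :
  \sum_(x in A) \sum_(y in A) p x * P x y * (f x - f y) ^+ 2
  = 2 * ip f f - 2 * ip f (op f).
Proof.
have -> : 2 * ip f f = ip f f + ip f f by ring.
rewrite -{1}sum_left -sum_right ip_opE -big_split /= mulr_sumr -sumrB.
apply: eq_bigr => x _; rewrite -big_split /= mulr_sumr -sumrB.
apply: eq_bigr => y _; ring.
Qed.

Let sum_sqrD f :
  \sum_(x in A) \sum_(y in A) p x * P x y * (f x + f y) ^+ 2
  = 2 * ip f f + 2 * ip f (op f).
Proof.
have -> : 2 * ip f f = ip f f + ip f f by ring.
rewrite -{1}sum_left -sum_right ip_opE -big_split /= mulr_sumr -big_split /=.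
apply: eq_bigr => x _; rewrite -big_split /= mulr_sumr -big_split /=.
apply: eq_bigr => y _; ring.
Qed.

(** [c] bounds the spectrum above by 1 - c on mean-zero functions; the factor 2 in [poincare] is
    that of the double sum. Holding probabilities at least [d] bound it below by -1 + 2d, hence by
    -(1 - c). *)
Variables (d c : R).
Hypothesis P_diag : forall x, x \in A -> d <= P x x.
Hypothesis c_le_2d : c <= 2 * d.
Hypothesis c_lt1 : c < 1.
Hypothesis poincare : forall f : T -> R, \sum_(x in A) p x * f x = 0 ->
  2 * c * \sum_(x in A) p x * f x ^+ 2 <=
  \sum_(x in A) \sum_(y in A) p x * P x y * (f x - f y) ^+ 2.

Let ip_ge0 f : 0 <= ip f f.
Proof.
apply: sumr_ge0 => x xA; rewrite -mulrA mulr_ge0 ?(ltW (p_gt0 xA)) //.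
by rewrite -expr2 sqr_ge0.
Qed.

Let ip_sqr f : \sum_(x in A) p x * f x ^+ 2 = ip f f.
Proof. by apply: eq_bigr => x _; rewrite -mulrA -expr2. Qed.

Let op_le f : \sum_(x in A) p x * f x = 0 -> ip f (op f) <= (1 - c) * ip f f.
Proof. by move=> /poincare; rewrite ip_sqr sum_sqrB; lra. Qed.

(* Keep only the diagonal terms of the quadratic form of [1 + P]. *)
Let op_ge f : - ((1 - c) * ip f f) <= ip f (op f).
Proof.
have : 4 * d * ip f f <= 2 * ip f f + 2 * ip f (op f).
  rewrite -sum_sqrD mulr_sumr; apply: ler_sum => x xA; rewrite (bigD1 x) //=.
  have -> : 4 * d * (p x * f x * f x) = p x * d * (f x + f x) ^+ 2 by ring.
  rewrite -[leLHS]addr0; apply: lerD.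
    by rewrite ler_wpM2r ?sqr_ge0 // ler_wpM2l ?P_diag // ltW ?p_gt0.
  apply: sumr_ge0 => y /andP[yA _].
  by rewrite mulr_ge0 ?sqr_ge0 // mulr_ge0 ?P_ge0 // ltW ?p_gt0.
have : 2 * c * ip f f <= 4 * d * ip f f.
  rewrite ler_wpM2r ?ip_ge0 //.
  have := c_le_2d.
  lra.
lra.
Qed.

Let ipD f g h : ip (fun x => f x + g x) h = ip f h + ip g h.
Proof. by rewrite -big_split /=; apply: eq_bigr => x _; ring. Qed.

Let ipZ a f h : ip (fun x => a * f x) h = a * ip f h.
Proof. by rewrite mulr_sumr; apply: eq_bigr => x _; ring. Qed.

(* Polarization replaces the spectral theorem in bounding the norm of [P]. *)
Let op_polar f g :
  \sum_(x in A) p x * f x = 0 -> \sum_(x in A) p x * g x = 0 ->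
  2 * ip g (op f) <= (1 - c) * (ip f f + ip g g).
Proof.
(* Four times [ip g (op f)] is [ip u (op u) - ip v (op v)]. Only the upper bound, applied to [u],
   needs mean zero. The factor [-1] is explicit so that [ipZ] applies. *)
move=> f0 g0; pose u x := f x + g x; pose v x := f x + -1 * g x.
have u0 : \sum_(x in A) p x * u x = 0.
  by under eq_bigr do rewrite mulrDr; rewrite big_split /= f0 g0 addr0.
have := op_le u0; have := op_ge v.
rewrite ![ip u _]ipD ![ip v _]ipD !ipZ.
rewrite [ip f (op u)]ip_op_sym [ip g (op u)]ip_op_sym [ip f (op v)]ip_op_sym.
rewrite [ip g (op v)]ip_op_sym ![ip u _]ipD ![ip v _]ipD !ipZ.
rewrite [ip f u]ipC [ip g u]ipC [ip f v]ipC [ip g v]ipC.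
rewrite ![ip u _]ipD ![ip v _]ipD !ipZ (ipC g f) (ip_op_sym f g).
lra.
Qed.

Let op_mean f : \sum_(x in A) p x * op f x = \sum_(x in A) p x * f x.
Proof.
rewrite (eq_bigr (fun x => \sum_(y in A) p x * P x y * f y)); last first.
  by move=> x xA; rewrite mulr_sumr; apply: eq_bigr => y _; rewrite mulrA.
rewrite exchange_big; apply: eq_bigr => y yA /=.
under eq_bigr => x xA do rewrite (P_rev xA yA).
by rewrite -mulr_suml -mulr_sumr P_sum1 // mulr1.
Qed.

Let op_contract f : \sum_(x in A) p x * f x = 0 ->
  ip (op f) (op f) <= (1 - c) ^+ 2 * ip f f.
Proof.
move=> f0; have b0 : 0 < 1 - c by rewrite subr_gt0.
(* With n and m the squared norms of [op f] and [f], polarization at this [g], multiplied by 1 - c,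
   reads 2n <= (1 - c)^2 m + n. *)
pose g x := (1 - c)^-1 * op f x.
have g0 : \sum_(x in A) p x * g x = 0.
  have -> : \sum_(x in A) p x * g x = (1 - c)^-1 * \sum_(x in A) p x * op f x.
    by rewrite mulr_sumr; apply: eq_bigr => x _; rewrite mulrCA.
  by rewrite op_mean f0 mulr0.
have := op_polar f0 g0.
rewrite !ipZ [ip (op f) g]ipC ipZ.
set n := ip (op f) (op f); set m := ip f f => le1.
have : (1 - c) * (2 * ((1 - c)^-1 * n))
  <= (1 - c) * ((1 - c) * (m + (1 - c)^-1 * ((1 - c)^-1 * n))).
  by rewrite ler_pM2l.
have -> : (1 - c) * (2 * ((1 - c)^-1 * n)) = 2 * n by field; rewrite gt_eqF.
have -> : (1 - c) * ((1 - c) * (m + (1 - c)^-1 * ((1 - c)^-1 * n)))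
  = (1 - c) ^+ 2 * m + n by field; rewrite gt_eqF.
by lra.
Qed.

(** * Convergence from a fixed starting state *)

Section Start.
Variable x : T.
Hypothesis xA : x \in A.

(** The density of the law at time [t] relative to [p], minus 1. *)
Let h t y := kernel_pow t x y / p y - 1.

(** Reversibility turns multiplication of the row vector by [P] on the right into the action of [op]
    on densities. *)
Let hS t y : y \in A -> h t.+1 y = op (h t) y.
Proof.
move=> yA; rewrite /h /op /= mulr_suml.
under [RHS]eq_bigr do rewrite mulrBr mulr1.
rewrite sumrB P_sum1 //; congr (_ - _); apply: eq_bigr => z zA.
have pz : p z != 0 by rewrite gt_eqF ?p_gt0.
have py : p y != 0 by rewrite gt_eqF ?p_gt0.
have -> : P z y = p y * P y z / p z by rewrite -P_rev // mulrAC mulfV ?mul1r.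
by field; rewrite pz py.
Qed.

Let h_mean t : \sum_(y in A) p y * h t y = 0.
Proof.
elim: t => [|t IH].
  under eq_bigr => y yA.
    have py : p y != 0 by rewrite gt_eqF ?p_gt0.
    rewrite /h /= mulrBr mulr1 mulrC divfK //.
    over.
  rewrite sumrB p_sum1 (bigD1 x) //= eqxx big1 ?addr0 ?subrr // => y.
  by case/andP=> _ /negPf; rewrite eq_sym => ->.
by rewrite -[RHS]IH -[RHS]op_mean; apply: eq_bigr => y yA; rewrite hS.
Qed.

Let h_norm t : ip (h t) (h t) <= ((1 - c) ^+ t) ^+ 2 / p x.
Proof.
elim: t => [|t IH].
  have px : p x != 0 by rewrite gt_eqF ?p_gt0.
  rewrite expr0 expr1n mul1r.
  (* Expanding the square leaves 1 / p(x) - 0 - 1 at time 0. *)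
  have -> : ip (h 0) (h 0) = \sum_(y in A) (x == y)%:R / p y
      - \sum_(y in A) p y * h 0 y - \sum_(y in A) (x == y)%:R.
    rewrite -!sumrB; apply: eq_bigr => y yA.
    have py : p y != 0 by rewrite gt_eqF ?p_gt0.
    by rewrite /h /=; case: eqP => _ /=; field.
  rewrite h_mean (bigD1 x) //= eqxx big1 => [|y /andP[_ /negPf]]; last first.
    by rewrite eq_sym => ->; rewrite mul0r.
  rewrite (bigD1 x) //= eqxx big1 => [|y /andP[_ /negPf]]; last first.
    by rewrite eq_sym => ->.
  by rewrite /= mul1r; lra.
have -> : ip (h t.+1) (h t.+1) = ip (op (h t)) (op (h t)).
  by apply: eq_bigr => y yA; rewrite !hS.
apply: le_trans (op_contract (h_mean t)) _.
by rewrite [(1 - c) ^+ t.+1]exprS exprMn -[leRHS]mulrA ler_wpM2l ?sqr_ge0.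
Qed.

(** The Cauchy-Schwarz inequality, obtained from the nonnegative variance of |h| under [p]. Both
    sides are squared to stay in an arbitrary ordered field. *)
Lemma kernel_pow_l1 t :
  (\sum_(y in A) `|kernel_pow t x y - p y|) ^+ 2 <= ((1 - c) ^+ t) ^+ 2 / p x.
Proof.
apply: le_trans (h_norm t).
set s := \sum_(y in A) _.
have sE : s = \sum_(y in A) p y * `|h t y|.
  apply: eq_bigr => y yA; have py := p_gt0 yA.
  rewrite -[X in X * _](gtr0_norm py) -normrM mulrBr mulr1 mulrCA mulfV ?mulr1 //.
  by rewrite gt_eqF.
clearbody s.
have : 0 <= \sum_(y in A) p y * (`|h t y| - s) ^+ 2.
  by apply: sumr_ge0 => y yA; rewrite mulr_ge0 ?sqr_ge0 // ltW ?p_gt0.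
have -> : \sum_(y in A) p y * (`|h t y| - s) ^+ 2 =
    ip (h t) (h t) - 2 * s * \sum_(y in A) p y * `|h t y|
    + s ^+ 2 * \sum_(y in A) p y.
  rewrite !mulr_sumr -sumrB -big_split /=; apply: eq_bigr => y yA.
  have hh : h t y * h t y = `|h t y| ^+ 2 by rewrite real_normK ?num_real ?expr2.
  rewrite -[p y * h t y * h t y]mulrA hh; ring.
by rewrite -sE p_sum1; lra.
Qed.

End Start.
End ReversibleChain.

(** * Winding *)

Lemma sqr_sum_le (R : realFieldType) m (a : nat -> R) :
  (\sum_(k < m) a k) ^+ 2 <= m%:R * \sum_(k < m) a k ^+ 2.
Proof.
elim: m => [|m IH]; first by rewrite !big_ord0 expr0n mulr0.
rewrite !big_ord_recr /= -natr1.
have : 2 * (\sum_(k < m) a k) * a m <= \sum_(k < m) a k ^+ 2 + m%:R * a m ^+ 2.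
  have -> : m%:R * a m ^+ 2 = \sum_(k < m) a m ^+ 2.
    by rewrite sumr_const card_ord mulr_natl.
  rewrite mulr_sumr mulr_suml -big_split; apply: ler_sum => k _ /=.
  by have := sqr_ge0 (a k - a m); nra.
nra.
Qed.

Lemma sum_widen (R : realFieldType) (I : finType) (P Q : pred I) (F : I -> R) :
  (forall i, P i -> Q i) -> (forall i, 0 <= F i) ->
  \sum_(i | P i) F i <= \sum_(i | Q i) F i.
Proof.
move=> PQ F0; rewrite big_mkcond [leRHS]big_mkcond; apply: ler_sum => i _.
by case: ifP => [/PQ ->//|_]; case: ifP.
Qed.

(** * Weights with a winding decomposition *)

Section Weights.
Variables (J : finType) (E : {set {set J}}).
Local Notation config := (config J).
Local Notation matching := {set {set J}}.
Local Notation splits := (splits E).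
Hypothesis hE : pair_partition E.

(** [b] is the witness of even-windability extended by 0 off the matchings, so that sums can run
    over all [M]. *)
Variables (R : realFieldType) (G : config -> R) (b : config -> config -> matching -> R).
Hypothesis G_ge0 : forall x, 0 <= G x.
Hypothesis b_ge0 : forall x y M, 0 <= b x y M.
Hypothesis b_Match : forall x y M, b x y M != 0 -> M \in Match (cxor x y).
Hypothesis b_sum : forall x y, G x * G y = \sum_M b x y M.
Hypothesis b_flip : forall x y (M : matching) S, S \in M ->
  b x y M = b (cflip x S) (cflip y S) M.

Lemma b_flips x y (M : matching) s : {subset s <= M} ->
  b x y M = b (cxor x (indic s)) (cxor y (indic s)) M.
Proof.
elim: s => [|S s IH] sM; first by rewrite !cxor0.
rewrite !cxor_cons -b_flip ?sM ?mem_head //; apply: IH => S' S's.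
by apply: sM; rewrite inE S's orbT.
Qed.

(** For fixed [k], translating both arguments by [c k] permutes the pairs (x, y). This is why the
    translation may depend on [k] only. *)
Lemma flip_sum_le (K : finType) (c : K -> config) (U V : config -> config -> K -> R) :
  (forall x y k, U x y k <= V (cxor x (c k)) (cxor y (c k)) k) ->
  \sum_x \sum_y \sum_k U x y k <= \sum_x \sum_y \sum_k V x y k.
Proof.
have sumC (W : config -> config -> K -> R) :
    \sum_x \sum_y \sum_k W x y k = \sum_k \sum_x \sum_y W x y k.
  by under eq_bigr do rewrite exchange_big; rewrite exchange_big.
move=> UV; rewrite !sumC; apply: ler_sum => k _.
rewrite [leRHS](reindex_inj (can_inj (cxorK (c k)))); apply: ler_sum => x _.
rewrite [leRHS](reindex_inj (can_inj (cxorK (c k)))); apply: ler_sum => y _.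
exact: UV.
Qed.

Definition layer k := \sum_(x | #|splits x| == k) G x.

Lemma layer_ge0 k : 0 <= layer k.
Proof. exact: sumr_ge0. Qed.

Lemma layer_prod k l : layer k * layer l =
  \sum_x \sum_y \sum_M
    if (#|splits x| == k) && (#|splits y| == l) then b x y M else 0.
Proof.
rewrite /layer big_distrlr /= big_mkcond; apply: eq_bigr => x _.
case: eqP => _ /=; last by rewrite big1 // => y _; rewrite big1.
rewrite big_mkcond; apply: eq_bigr => y _.
by case: eqP => _ /=; [rewrite b_sum | rewrite big1].
Qed.

(** For each [M], flipping the half from [winding_split] carries pairs in layers 4 and 0 injectively
    to pairs in layer 2, with the same [b]. *)
Lemma layer_log_concave : layer 4 * layer 0%N <= layer 2 ^+ 2.
Proof.
have [c cP] := fin_all_exists (winding_split hE).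
rewrite expr2 !layer_prod; apply: (flip_sum_le (c := fun M => indic (c M))).
move=> x y M; case: ifP => [/andP[/eqP x4 /eqP y0]|_]; last by case: ifP.
have [->|bn0] := eqVneq (b x y M) 0; first by case: ifP.
have [cM -> ->] := cP M x y (b_Match bn0) x4 y0.
by rewrite !eqxx (b_flips _ _ cM).
Qed.

Definition in02 x := (#|splits x| == 0%N) || (#|splits x| == 2).
Definition in024 x := in02 x || (#|splits x| == 4).

Lemma sum_in02 (g : config -> R) : \sum_(x | in02 x) g x =
  \sum_(x | #|splits x| == 0%N) g x + \sum_(x | #|splits x| == 2) g x.
Proof.
rewrite (bigID (fun x => #|splits x| == 0%N)) /=; congr (_ + _); apply: eq_bigl => x;
  by rewrite /in02; case: #|splits x| => [|[|[|m]]].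
Qed.

Lemma sum_in024 (g : config -> R) : \sum_(x | in024 x) g x =
  \sum_(x | in02 x) g x + \sum_(x | #|splits x| == 4) g x.
Proof.
rewrite (bigID in02) /=; congr (_ + _); apply: eq_bigl => x;
  by rewrite /in024 /in02; case: #|splits x| => [|[|[|[|[|m]]]]].
Qed.

(** * Flow along winding paths *)

Section Flow.
Variable f : config -> R.

Lemma telescope x s : f x - f (cxor x (indic s)) =
  \sum_(k < size s) (f (cxor x (indic (take k s))) - f (cxor x (indic (take k.+1 s)))).
Proof.
have := @telescope_sumr R 0 (size s) (fun k => - f (cxor x (indic (take k s)))).
rewrite big_mkord => /(_ (leq0n _)).
rewrite take0 cxor0 take_size opprK addrC => <-.
by apply: eq_bigr => k _; rewrite opprK addrC.
Qed.

(** From [x], the prefix leads to where the suffix leads from [y], so the split pairs are those of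
    the suffix, at most 2. From [y], they are those of the prefix, the symmetric difference of those
    of [x] and of the suffix, at most 4. Parity rules out 1 and 3. *)
Lemma winding_step_splits x y M s k :
  M \in Match (cxor x y) -> in02 x -> #|splits y| = 0%N -> perm_eq (enum M) s ->
  (forall j, (#|splits (indic (drop j s))| <= 2)%N) ->
  in02 (cxor x (indic (take k s))) && in024 (cxor y (indic (take k s))).
Proof.
move=> MM x02 y0 Ms sk.
have s2 : {in s, forall S : {set J}, #|S| = 2}.
  move=> S; rewrite -(perm_mem Ms) mem_enum; exact: (Match_card2 MM).
have ev1 : ~~ odd #|splits (indic (take k s))|.
  by apply: splits_indic_even => // S /mem_take; apply: s2.
have ev2 : ~~ odd #|splits (indic (drop k s))|.
  by apply: splits_indic_even => // S /mem_drop; apply: s2.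
have xyE : cxor x y = cxor (indic (take k s)) (indic (drop k s)).
  by rewrite -indic_cat cat_take_drop -(perm_indic Ms) (Match_indic MM).
have xE : cxor x (indic (take k s)) = cxor (indic (drop k s)) y.
  have -> : x = cxor (cxor x y) y by rewrite cxorK.
  rewrite xyE [RHS]cxorC cxorC !cxorA cxorxx [cxor (indic [::]) _]cxorC cxor0.
  by rewrite cxorC.
have tE : indic (take k s) = cxor (cxor x y) (indic (drop k s)).
  by rewrite xyE cxorK.
rewrite /in024 /in02 xE splits_xor0 // cxorC splits_xor0 //.
have xyS : splits (cxor x y) = splits x by rewrite splits_xor0.
have : (#|splits (indic (take k s))| <= 4)%N.
  rewrite tE splits_xor // xyS.
  have := card_symdiff (splits x) (splits (indic (drop k s))).
  have := sk k; move: x02; rewrite /in02; lia.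
have := sk k; lia.
Qed.

Let jump z S := (f z - f (cflip z S)) ^+ 2.

(** Telescoping and Cauchy-Schwarz. Steps are indexed by the flipped pair [S] instead of its
    position, which makes (M, S) a label for the double counting. *)
Lemma path_jumps x y M s : M \in Match (cxor x y) -> perm_eq (enum M) s ->
  (f x - f y) ^+ 2 <=
  #|J|%:R * \sum_(S in M) jump (cxor x (indic (take (index S s) s))) S.
Proof.
move=> MM Ms; have us : uniq s by rewrite -(perm_uniq Ms) enum_uniq.
have -> : y = cxor x (indic s).
  rewrite -(perm_indic Ms) (Match_indic MM) cxorA cxorxx cxorC cxor0 //.
rewrite telescope.
pose a k := f (cxor x (indic (take k s))) - f (cxor x (indic (take k.+1 s))).
apply: le_trans (sqr_sum_le _ a) _.
have -> : \sum_(S in M) jump (cxor x (indic (take (index S s) s))) S =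
    \sum_(k < size s) a k ^+ 2.
  rewrite -big_enum /= (perm_big s) //= (big_nth set0) big_mkord.
  apply: eq_bigr => k _; rewrite index_uniq // /jump /a; congr ((_ - f _) ^+ 2).
  rewrite -cxor_cons; congr cxor; apply: perm_indic.
  by rewrite (take_nth set0) // perm_sym perm_rcons.
rewrite ler_wpM2r ?sumr_ge0 // => [k _|]; first exact: sqr_ge0.
by rewrite ler_nat -(perm_size Ms) -cardE (Match_size MM).
Qed.

(* Flipping [S] on both sides preserves [b], so the load is bounded by both
   endpoints of the edge. *)
Lemma edge_load z S :
  \sum_(z' | in024 z' && in024 (cflip z' S)) \sum_(M : matching | S \in M) b z z' M
  <= Num.min (G z) (G (cflip z S)) * \sum_(x | in024 x) G x.
Proof.
have flip_sum : \sum_(z' | in024 z' && in024 (cflip z' S)) G (cflip z' S)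
    <= \sum_(x | in024 x) G x.
  rewrite [leRHS](reindex_inj (can_inj (cflipK S))).
  by apply: sum_widen => // x /andP[].
have sum_le z1 z2 : \sum_(M : matching | S \in M) b z1 z2 M <= G z1 * G z2.
  by rewrite b_sum; apply: sum_widen.
case: (leP (G z)) => _.
  rewrite mulr_sumr.
  apply: (@le_trans _ _ (\sum_(z' | in024 z' && in024 (cflip z' S)) G z * G z')).
    by apply: ler_sum => z' _; apply: sum_le.
  by apply: sum_widen => [x /andP[]|x] //; rewrite mulr_ge0.
apply: le_trans (ler_wpM2l (G_ge0 _) flip_sum); rewrite mulr_sumr.
apply: ler_sum => z' _; under eq_bigr => M SM do rewrite (b_flip _ _ SM).
exact: sum_le.
Qed.

Lemma flow_bound :
  \sum_(x | in02 x) \sum_(y | #|splits y| == 0%N) G x * G y * (f x - f y) ^+ 2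
  <= #|J|%:R * (\sum_(x | in024 x) G x) *
     \sum_(z | in02 z) \sum_(w | in02 w && (hdist z w == 2))
       Num.min (G z) (G w) * (f z - f w) ^+ 2.
Proof.
have [ord ordP] := fin_all_exists (winding_order hE).
(* The pairs flipped before [S] on the path of [M]: a function of (M, S) alone, as [flip_sum_le]
   requires. [U] charges a step to the endpoints of its path; [V] charges it to the current
   configuration and its complement. *)
pose pre (k : matching * {set J}) := take (index k.2 (ord k.1)) (ord k.1).
pose U x y (k : matching * {set J}) :=
  if [&& in02 x, #|splits y| == 0%N & k.2 \in k.1]
  then b x y k.1 * jump (cxor x (indic (pre k))) k.2 else 0.
pose V z z' (k : matching * {set J}) :=
  if [&& in02 z && in02 (cflip z k.2), in024 z' && in024 (cflip z' k.2),
      #|k.2| == 2 & k.2 \in k.1]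
  then b z z' k.1 * jump z k.2 else 0.
have jump_ge0 z S : 0 <= jump z S by apply: sqr_ge0.
have V_ge0 z z' k : 0 <= V z z' k.
  by rewrite /V; case: ifP => // _; rewrite mulr_ge0.
have sumU : \sum_(x | in02 x) \sum_(y | #|splits y| == 0%N)
    G x * G y * (f x - f y) ^+ 2 <= #|J|%:R * \sum_x \sum_y \sum_k U x y k.
  rewrite mulr_sumr big_mkcond; apply: ler_sum => x _; rewrite mulr_sumr.
  case: ifP => x02; last first.
    apply: sumr_ge0 => y _; rewrite mulr_ge0 // sumr_ge0 // => k _.
    by rewrite /U x02.
  rewrite big_mkcond; apply: ler_sum => y _.
  case: ifP => y0; last by rewrite big1 ?mulr0 // => k _; rewrite /U y0 andbF.
  have -> : \sum_k U x y k = \sum_M \sum_S U x y (M, S).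
    by rewrite pair_bigA; apply: eq_bigr => -[].
  rewrite b_sum mulr_suml mulr_sumr; apply: ler_sum => M _.
  have -> : \sum_S U x y (M, S) =
      b x y M * \sum_(S in M) jump (cxor x (indic (pre (M, S)))) S.
    rewrite mulr_sumr [RHS]big_mkcond; apply: eq_bigr => S _.
    by rewrite /U x02 y0.
  have [->|bn0] := eqVneq (b x y M) 0; first by rewrite !mul0r mulr0.
  rewrite [leRHS]mulrCA ler_wpM2l //; apply: (@path_jumps x y M (ord M)); first exact: b_Match.
  have x2 : (#|splits x| <= 2)%N by move: x02; rewrite /in02; lia.
  by have [] := ordP M x y (b_Match bn0) x2 (eqP y0).
have UV x y k :
    U x y k <= V (cxor x (indic (pre k))) (cxor y (indic (pre k))) k.
  case: k => M S; rewrite [U _ _ _]/U /=.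
  case: ifP => [/and3P[x02 /eqP y0 SM]|_]; last exact: V_ge0.
  have [->|bn0] := eqVneq (b x y M) 0; first by rewrite mul0r V_ge0.
  have MM := b_Match bn0.
  have x2 : (#|splits x| <= 2)%N by move: x02; rewrite /in02; lia.
  have [Ms sk] := ordP M x y MM x2 y0.
  have Ss : S \in ord M by rewrite -(perm_mem Ms) mem_enum.
  have /andP[zi z'i] := winding_step_splits (index S (ord M)) MM x02 y0 Ms sk.
  have /andP[wi w'i] := winding_step_splits (index S (ord M)).+1 MM x02 y0 Ms sk.
  have takeS : indic (take (index S (ord M)).+1 (ord M)) = indic (S :: pre (M, S)).
    apply: perm_indic; rewrite (take_nth S) ?index_mem // nth_index //.
    by rewrite perm_rcons.
  move: wi w'i; rewrite takeS !cxor_cons => wi w'i.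
  rewrite /V /= zi z'i wi w'i SM (Match_card2 MM SM) /= -b_flips //.
  by move=> S' /mem_take; rewrite -(perm_mem Ms) mem_enum.
apply: (le_trans sumU); rewrite -mulrA ler_wpM2l //.
apply: (le_trans (flip_sum_le UV)).
rewrite mulr_sumr [leRHS]big_mkcond; apply: ler_sum => z _.
have -> : \sum_z' \sum_k V z z' k = \sum_S \sum_z' \sum_M V z z' (M, S).
  rewrite [RHS]exchange_big /=; apply: eq_bigr => z' _.
  by rewrite [RHS]exchange_big pair_bigA; apply: eq_bigr => -[].
case: ifP => z02; last first.
  rewrite big1 // => S _; rewrite big1 // => z' _; rewrite big1 // => M _.
  by rewrite /V z02.
(* The neighbours [w] of [z] correspond to the sets [S] of size 2 with w = [cflip z S]. *)
rewrite [X in _ * X](reindex (cflip z)) /=; last first.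
  exists (fun w => [set i | z i != w i]) => [S _|w _].
    by apply/setP=> i; rewrite !inE ffunE; case: (z i); case: (i \in S).
  by apply/ffunP=> i; rewrite ffunE inE; case: (z i); case: (w i).
rewrite mulr_sumr [leRHS]big_mkcond; apply: ler_sum => S _.
rewrite hdist_cflip; case: ifP => wS; last first.
  rewrite big1 // => z' _; rewrite big1 // => M _.
  by rewrite /V /= z02 /=; case: (in02 _) (#|S| == 2) wS => [] [] //= _; rewrite ?andbF.
case/andP: wS => w02 S2.
have -> : \sum_z' \sum_M V z z' (M, S) = jump z S *
    \sum_(z' | in024 z' && in024 (cflip z' S)) \sum_(M : matching | S \in M) b z z' M.
  rewrite mulr_sumr [RHS]big_mkcond; apply: eq_bigr => z' _.
  rewrite /V /= z02 w02 S2 /=; case: ifP => _; last by rewrite big1.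
  rewrite mulr_sumr [RHS]big_mkcond; apply: eq_bigr => M _.
  by rewrite [b _ _ _ * _]mulrC; case: (S \in M).
rewrite -/(jump z S) [leRHS]mulrA [leRHS]mulrC ler_wpM2l //.
by rewrite [leRHS]mulrC edge_load.
Qed.

End Flow.
Lemma winding_poincare (f : config -> R) :
  \sum_(x | in02 x) G x = 1 -> \sum_(x | in02 x) G x * f x = 0 ->
  layer 0%N ^+ 2 * (\sum_(x | in02 x) G x * f x ^+ 2) <=
  #|J|%:R * \sum_(z | in02 z) \sum_(w | in02 w && (hdist z w == 2))
    Num.min (G z) (G w) * (f z - f w) ^+ 2.
Proof.
move=> G1 f0; set v := (X in _ * X <= _); set S := (X in _ <= _ * X).
have := flow_bound f; rewrite -/S => flow.
have S_ge0 : 0 <= S.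
  apply: sumr_ge0 => z _; apply: sumr_ge0 => w _.
  by apply: mulr_ge0 (sqr_ge0 _); rewrite le_min !G_ge0.
(* The cross term vanishes with the mean of [f], and the square of [f] on layer 0 is dropped. *)
have lower : layer 0%N * v <=
    \sum_(x | in02 x) \sum_(y | #|splits y| == 0%N) G x * G y * (f x - f y) ^+ 2.
  have -> : \sum_(x | in02 x) \sum_(y | #|splits y| == 0%N)
      G x * G y * (f x - f y) ^+ 2 =
      v * layer 0%N + (\sum_(x | in02 x) G x) *
        (\sum_(y | #|splits y| == 0%N) G y * f y ^+ 2)
      - 2 * ((\sum_(x | in02 x) G x * f x) *
        (\sum_(y | #|splits y| == 0%N) G y * f y)).
    rewrite /layer !big_distrlr mulr_sumr -big_split -sumrB /=.
    apply: eq_bigr => x _; rewrite mulr_sumr -big_split -sumrB /=.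
    by apply: eq_bigr => y _; ring.
  rewrite G1 f0 mul0r mulr0 subr0 mul1r [layer 0%N * v]mulrC lerDl.
  by apply: sumr_ge0 => y _; rewrite mulr_ge0 ?sqr_ge0.
(* With l_k the layers and l_0 + l_2 = 1: (1 + l_4) l_0 <= l_0 + l_2^2 <= l_0 + l_2 = 1. *)
have G4 : (\sum_(x | in024 x) G x) * layer 0%N <= 1.
  rewrite sum_in024 G1 -/(layer 4).
  have := layer_log_concave; have := layer_ge0 0%N; have := layer_ge0 2.
  by move: G1; rewrite sum_in02 -/(layer 0%N) -/(layer 2); nra.
have := ler_wpM2l (layer_ge0 0%N) (le_trans lower flow).
rewrite mulrA -expr2 => /le_trans; apply.
rewrite [leLHS](_ : _ = #|J|%:R * (S * ((\sum_(x | in024 x) G x) * layer 0%N))); last ring.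
by rewrite ler_wpM2l // -[leRHS]mulr1 ler_wpM2l.
Qed.

(** * The Metropolis chain *)

Section Metropolis.
Variable Om : {set config}.
Hypothesis OmE : forall x, (x \in Om) = in02 x && (0 < G x).
Hypothesis Om1 : \sum_(x in Om) G x = 1.
Hypothesis J2 : (2 <= #|J|)%N.

Let rate : R := 2 / #|J|%:R ^+ 2.

Definition metropolis x y : R :=
  if x == y then
    1 - rate * \sum_(y' in Om | hdist x y' == 2) Num.min 1 (G y' / G x)
  else if hdist x y == 2 then rate * Num.min 1 (G y / G x) else 0.

Let n_gt0 : 0 < #|J|%:R :> R.
Proof. by rewrite ltr0n (leq_trans _ J2). Qed.

Let rate_ge0 : 0 <= rate.
Proof. by rewrite divr_ge0 ?exprn_ge0 // ltW. Qed.

Let Om_gt0 x : x \in Om -> 0 < G x.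
Proof. by rewrite OmE => /andP[]. Qed.

(** Winding paths live on [in02], the chain on [Om]; they differ by configurations of weight 0. *)
Let sum_Om (H : config -> R) :
  (forall x, G x = 0 -> H x = 0) -> \sum_(x | in02 x) H x = \sum_(x in Om) H x.
Proof.
move=> H0; rewrite big_mkcond [RHS]big_mkcond; apply: eq_bigr => x _.
rewrite OmE lt0r G_ge0 andbT; case: (in02 x) => //=.
by case: eqP => //= /H0.
Qed.

Let metropolis_off x : \sum_(y in Om | y != x) metropolis x y =
  rate * \sum_(y in Om | hdist x y == 2) Num.min 1 (G y / G x).
Proof.
rewrite mulr_sumr big_mkcondr [RHS]big_mkcondr; apply: eq_bigr => y _.
rewrite /metropolis eq_sym; case: eqP => [->|_] //=.
by rewrite hdistxx.
Qed.

Let metropolis_sum1 x : x \in Om -> \sum_(y in Om) metropolis x y = 1.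
Proof.
move=> xOm; rewrite (bigD1 x) //= metropolis_off /metropolis eqxx; ring.
Qed.

Let flow_metropolis x y : x \in Om -> y \in Om -> x != y ->
  G x * metropolis x y = if hdist x y == 2 then rate * Num.min (G x) (G y) else 0.
Proof.
move=> xOm yOm xy; rewrite /metropolis (negPf xy); case: ifP => _; last by rewrite mulr0.
rewrite mulrCA minr_pMr ?ltW ?Om_gt0 // mulr1 mulrCA mulfV ?mulr1 //.
by rewrite gt_eqF ?Om_gt0.
Qed.

Let metropolis_rev x y : x \in Om -> y \in Om ->
  G x * metropolis x y = G y * metropolis y x.
Proof.
move=> xOm yOm; have [->//|xy] := eqVneq x y.
have yx : y != x by rewrite eq_sym.
by rewrite !flow_metropolis // hdistC minC.
Qed.

(** At most n(n - 1)/2 configurations lie at distance 2, and each is proposed with probability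
    2/n^2, so the chain leaves [x] with probability at most 1 - 1/n. *)
Let metropolis_diag x : x \in Om -> #|J|%:R^-1 <= metropolis x x.
Proof.
move=> xOm; rewrite /metropolis eqxx.
have le1 : \sum_(y in Om | hdist x y == 2) Num.min 1 (G y / G x) <= 'C(#|J|, 2)%:R.
  apply: (@le_trans _ _ (\sum_(y in [set y | hdist x y == 2]) 1)).
    rewrite (eq_bigl (fun y => (hdist x y == 2) && (y \in Om))); last first.
      by move=> y; rewrite andbC.
    rewrite big_mkcondr /= (eq_bigl (fun y => y \in [set y | hdist x y == 2])).
      by apply: ler_sum => y _; case: ifP => // _; rewrite ge_min lexx.
    by move=> y; rewrite inE.
  rewrite sumr_const ler_nat -card_draws.
  apply: leq_trans (leq_imset_card (cflip x) _); apply: subset_leq_card.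
  apply/subsetP=> y; rewrite inE => xy.
  apply/imsetP; exists [set i | x i != y i]; first by rewrite inE.
  by apply/ffunP=> i; rewrite ffunE inE; case: (x i); case: (y i).
have := ler_wpM2l rate_ge0 le1.
have -> : rate * 'C(#|J|, 2)%:R = 1 - #|J|%:R^-1.
  have C2 : 2 * 'C(#|J|, 2)%:R = #|J|%:R * (#|J|%:R - 1) :> R.
    rewrite -natrM mulnC bin2 -divn2 divnK.
      by rewrite natrM -subn1 natrB // (leq_trans _ J2).
    by rewrite dvdn2; case: #|J| => //= m; rewrite oddM /=; case: (odd m).
  rewrite /rate mulrAC C2; field.
  by rewrite gt_eqF.
by lra.
Qed.

Let metropolis_ge0 x y : x \in Om -> y \in Om -> 0 <= metropolis x y.
Proof.
move=> xOm yOm; have [<-|xy] := eqVneq x y.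
  by apply: le_trans (metropolis_diag xOm); rewrite invr_ge0 ltW.
rewrite /metropolis (negPf xy); case: ifP => // _.
by rewrite mulr_ge0 // le_min ler01 divr_ge0.
Qed.

Let metropolis_poincare (f : config -> R) : \sum_(x in Om) G x * f x = 0 ->
  2 * (layer 0%N ^+ 2 / #|J|%:R ^+ 4) * \sum_(x in Om) G x * f x ^+ 2 <=
  \sum_(x in Om) \sum_(y in Om) G x * metropolis x y * (f x - f y) ^+ 2.
Proof.
move=> f0.
have G1 : \sum_(x | in02 x) G x = 1 by rewrite sum_Om.
have f0' : \sum_(x | in02 x) G x * f x = 0.
  by rewrite sum_Om // => x ->; rewrite mul0r.
have := winding_poincare G1 f0'.
rewrite sum_Om => [|x ->]; last by rewrite mul0r.
rewrite sum_Om => [|x Gx0]; last first.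
  by rewrite big1 // => y _; rewrite Gx0 min_l ?mul0r.
set v := (X in _ * X <= _); set S := (X in _ <= _ * X) => poin.
have S_ge0 : 0 <= S.
  apply: sumr_ge0 => z _; apply: sumr_ge0 => w _.
  by apply: mulr_ge0 (sqr_ge0 _); rewrite le_min !G_ge0.
have -> : \sum_(x in Om) \sum_(y in Om) G x * metropolis x y * (f x - f y) ^+ 2
    = rate * S.
  rewrite mulr_sumr; apply: eq_bigr => x xOm.
  rewrite big_mkcondr (sum_Om (H := fun y => if hdist x y == 2 then
     Num.min (G x) (G y) * (f x - f y) ^+ 2 else 0)); last first.
    by move=> y Gy0; case: ifP => // _; rewrite Gy0 min_r ?mul0r.
  rewrite mulr_sumr; apply: eq_bigr => y yOm.
  have [->|xy] := eqVneq x y; first by rewrite hdistxx subrr expr0n !mulr0.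
  by rewrite flow_metropolis //; case: ifP => _; rewrite ?mul0r ?mulr0 ?mulrA.
have n1 : 1 <= #|J|%:R :> R by rewrite ler1n (leq_trans _ J2).
have -> : 2 * (layer 0%N ^+ 2 / #|J|%:R ^+ 4) * v = 2 / #|J|%:R ^+ 4 * (layer 0%N ^+ 2 * v).
  by ring.
(* [winding_poincare] gives a single factor n; the second one is slack, absorbed by n >= 1. *)
have -> : rate * S = 2 / #|J|%:R ^+ 4 * (#|J|%:R * (#|J|%:R * S)).
  by rewrite /rate; field; rewrite gt_eqF.
rewrite ler_wpM2l ?divr_ge0 ?exprn_ge0 ?(ltW n_gt0) //.
apply: (le_trans poin); rewrite ler_wpM2l ?(ltW n_gt0) // ler_peMl //.
Qed.

(** Compares the Poincare constant with the holding probability, as [c_le_2d] demands. *)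
Lemma metropolis_gap_le : layer 0%N ^+ 2 / #|J|%:R ^+ 4 <= #|J|%:R^-1.
Proof.
have n1 : 1 <= #|J|%:R :> R by rewrite ler1n (leq_trans _ J2).
have l1 : layer 0%N ^+ 2 <= 1.
  rewrite expr_le1 ?layer_ge0 // -Om1 -sum_Om // sum_in02 lerDl.
  exact: layer_ge0.
have n4 : #|J|%:R <= #|J|%:R ^+ 4 :> R by rewrite -[leLHS]expr1 ler_weXn2l.
rewrite ler_pdivrMr ?exprn_gt0 // (le_trans l1) //.
by rewrite -(@ler_pM2l _ #|J|%:R) // mulr1 mulrA mulfV ?mul1r // gt_eqF.
Qed.

Lemma metropolis_gap_lt1 : layer 0%N ^+ 2 / #|J|%:R ^+ 4 < 1.
Proof. by rewrite (le_lt_trans metropolis_gap_le) // invf_lt1 // ltr1n. Qed.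

Theorem metropolis_mixing t x : x \in Om ->
  (\sum_(y in Om) `|kernel_pow Om metropolis t x y - G y|) ^+ 2 <=
  ((1 - layer 0%N ^+ 2 / #|J|%:R ^+ 4) ^+ t) ^+ 2 / G x.
Proof.
move=> xOm; apply: (kernel_pow_l1 Om_gt0 Om1 metropolis_ge0 metropolis_sum1
  metropolis_rev metropolis_diag _ _ metropolis_poincare) => //.
  have : 0 < #|J|%:R^-1 :> R by rewrite invr_gt0.
  have := metropolis_gap_le; lra.
exact: metropolis_gap_lt1.
Qed.

End Metropolis.
End Weights.

(** * The Metropolis chain of an even-windable function *)

Lemma posQ_Q2R (q : Q) : posQ q = (0 < Q2R q :> R).
Proof.
have Q0 : Q2R (Qmake 0 1) = 0 by rewrite /Q2R /= RmultE mul0r.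
apply/idP/idP => [/negP q0|/RltP q0].
  apply/RltP; rewrite -[X in Rlt X _]Q0.
  by apply/Qlt_Rlt/QOrderedType.QOrder.not_ge_lt => /Qle_bool_iff.
apply/negP => /Qle_bool_iff/Qle_Rle; rewrite Q0 => /Rle_not_lt; exact.
Qed.

Lemma Q2R_sum (I : finType) (P : pred I) (f : I -> Q) :
  Q2R (\big[Qplus/Qmake 0 1]_(i | P i) f i) = \sum_(i | P i) (Q2R (f i) : R).
Proof.
apply: (big_morph Q2R); first exact: Q2R_plus.
by rewrite /Q2R /= RmultE mul0r.
Qed.

(** The power of 1 - c <= exp(-c); [c <= 1] keeps the base nonnegative. *)
Lemma onesubX_le_exp (c : R) (t : nat) :
  c <= 1 -> (1 - c) ^+ t <= exp (- (t%:R * c))%R.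
Proof.
move=> c1.
have -> : exp (- (t%:R * c))%R = exp (- c)%R ^+ t.
  elim: t => [|t IH]; first by rewrite mulr0n mul0r oppr0 expr0; exact: exp_0.
  rewrite exprS -IH -[RHS]RmultE -exp_plus; congr exp.
  rewrite -natr1 RplusE; ring.
apply: lerXn2r; rewrite ?nnegrE ?subr_ge0 //.
  by apply/ltW/RltP/exp_pos.
by have /RleP := exp_ineq1_le (- c)%R.
Qed.

Section WindableChain.
Variables (J : finType) (E : {set {set J}}) (F : config J -> Q).
Hypothesis hn : (2 <= #|J|)%N.
Hypothesis hE : pair_partition E.
Hypothesis hF : forall x, Qle 0 (F x).
Hypothesis hEW : even_windable F.
Hypothesis hO0 : exists x, x \in Omega_k E F 0.

Let Z : R := \sum_(y in Omega E F) FR F y.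

Lemma FR_ge0 x : 0 <= FR F x.
Proof.
by apply/RleP; have := Qle_Rle _ _ (@hF x); rewrite {1}/Q2R /= RmultE mul0r.
Qed.

Lemma Z_gt0 : 0 < Z.
Proof.
have [x xO] := hO0.
have xOm : x \in Omega E F by rewrite inE xO.
rewrite /Z (bigD1 x) //= ltr_pwDl ?sumr_ge0 // => [|y _]; last exact: FR_ge0.
by move: xO; rewrite inE posQ_Q2R => /andP[].
Qed.

Lemma piRE x : piR E F x = FR F x / Z.
Proof. by rewrite /piR RdivE. Qed.

Lemma Omega_in02 x : (x \in Omega E F) = in02 E x && (0 < piR E F x).
Proof.
rewrite !inE /kassign -/(splits E x) /in02 -andb_orl piRE pmulr_lgt0 ?invr_gt0 ?Z_gt0 //.
by rewrite posQ_Q2R.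
Qed.

Lemma piOmega0E : piOmega0 E F = layer E (piR E F) 0%N.
Proof.
rewrite /piOmega0 /layer [RHS]big_mkcond [LHS]big_mkcond; apply: eq_bigr => x _.
rewrite inE /kassign -/(splits E x); case: eqP => //= _.
rewrite posQ_Q2R -/(FR F x) lt0r FR_ge0 andbT; case: eqP => //= Fx.
by rewrite piRE Fx mul0r.
Qed.

Lemma PmatE x y : Pmat E F x y = metropolis (piR E F) (Omega E F) x y.
Proof.
have ratio z w : FR F z / FR F w = piR E F z / piR E F w.
  by rewrite !piRE [(FR F w / Z)^-1]invf_div mulrA divfK // gt_eqF ?Z_gt0.
rewrite /Pmat /metropolis RdivE RpowE INRE.
case: eqP => _.
  rewrite RminusE RmultE; congr (_ - _ * _).
  by apply: eq_bigr => z _; rewrite RminE RdivE ratio.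
by case: eqP => // _; rewrite RmultE RminE RdivE ratio.
Qed.

Lemma PpowE t x y :
  Ppow E F t x y = kernel_pow (Omega E F) (metropolis (piR E F) (Omega E F)) t x y.
Proof.
elim: t y => [|t IH] y /=; first by case: eqP.
by apply: eq_bigr => z _; rewrite IH PmatE.
Qed.

Lemma piR_sum1 : \sum_(x in Omega E F) piR E F x = 1.
Proof.
under eq_bigr do rewrite piRE.
by rewrite -mulr_suml -/Z mulfV // gt_eqF ?Z_gt0.
Qed.

Lemma piR_ge0 x : 0 <= piR E F x.
Proof. by rewrite piRE divr_ge0 ?FR_ge0 // ltW ?Z_gt0. Qed.

Lemma gap_lt1 : piOmega0 E F ^+ 2 / #|J|%:R ^+ 4 < 1.
Proof.
by rewrite piOmega0E; apply: metropolis_gap_lt1 piR_ge0 _ Omega_in02 piR_sum1 hn.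
Qed.

Lemma l1_distance_le t x : x \in Omega E F ->
  (\sum_(y in Omega E F) `|Ppow E F t x y - piR E F y|) ^+ 2 <=
  ((1 - piOmega0 E F ^+ 2 / #|J|%:R ^+ 4) ^+ t) ^+ 2 / piR E F x.
Proof.
move=> xOm; have [B [B_ge0 [B_sum B_flip]]] := hEW.
under eq_bigr do rewrite PpowE.
rewrite piOmega0E.
(* Dividing by [Z ^+ 2] normalizes the product of two values of [F] to that of two values of
   [piR]. *)
pose b x y M : R := if M \in Match (cxor x y) then Q2R (B x y M) / Z ^+ 2 else 0.
have cxor_flip (u v : config J) S : cxor (cflip u S) (cflip v S) = cxor u v.
  by apply/ffunP=> i; rewrite !ffunE addbACA addbb addbF.
apply: (@metropolis_mixing J E hE _ (piR E F) b) => //.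
- exact: piR_ge0.
- move=> u v M; rewrite /b; case: ifP => // /B_ge0/Qle_Rle/RleP.
  rewrite {1}/Q2R /= RmultE mul0r => B0.
  by rewrite divr_ge0 ?exprn_ge0 // ltW ?Z_gt0.
- by move=> u v M; rewrite /b; case: ifP => //; rewrite eqxx.
- move=> u v; rewrite -big_mkcond /= -mulr_suml -Q2R_sum.
  rewrite -(Qeq_eqR _ _ (B_sum u v)) Q2R_mult !piRE RmultE.
  by rewrite expr2 invfM mulrACA.
- move=> u v M S SM; rewrite /b cxor_flip; case: ifP => // MM.
  by rewrite (Qeq_eqR _ _ (B_flip u v M S MM SM)).
- exact: Omega_in02.
exact: piR_sum1.
Qed.

End WindableChain.

Local Open Scope nat_scope.

Theorem theorem5 (J : finType) (E : {set {set J}}) (F : config J -> Q)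
  (hn : 2 <= #|J|)
  (hE : pair_partition E)
  (hF : forall x, Qle 0 (F x))
  (hEW : even_windable F)
  (hO0 : exists x, x \in Omega_k E F 0) :
  forall (x : config J), x \in Omega E F -> forall t : nat,
    Rle (Rmult (Rinv (IZR 2))
           (\big[Rplus/R0]_(y in Omega E F) Rabs (Rminus (Ppow E F t x y) (piR E F y))))
        (Rmult (Rmult (Rinv (IZR 2)) (Rinv (sqrt (piR E F x))))
           (exp (Ropp (Rdiv (Rmult (INR t) (pow (piOmega0 E F) 2)) (pow (INR #|J|) 4))))).
Proof.
move=> x xOm t.
have px : (0 < piR E F x)%R by move: xOm; rewrite Omega_in02 // => /andP[].
have gap1 := gap_lt1 hn hF hO0.
set e := exp _.
have e_ge0 : (0 <= e)%R by apply/ltW/RltP/exp_pos.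
have powt : ((1 - piOmega0 E F ^+ 2 / #|J|%:R ^+ 4) ^+ t <= e)%R.
  by rewrite /e INRE RdivE !RpowE RmultE RoppE INRE -mulrA onesubX_le_exp // ltW.
have dist : (\sum_(y in Omega E F) `|Ppow E F t x y - piR E F y|
    <= (sqrt (piR E F x))^-1 * e)%R.
  (* Both sides are nonnegative, so it suffices to compare squares. *)
  rewrite RsqrtE -(@ler_pXn2r _ 2) ?nnegrE ?sumr_ge0 ?mulr_ge0 ?invr_ge0 ?sqrtr_ge0 //.
  rewrite exprMn exprVn sqr_sqrtr ?(ltW px) // [leRHS]mulrC.
  apply: le_trans (l1_distance_le hn hE hF hEW hO0 t xOm) _.
  rewrite ler_wpM2r ?invr_ge0 ?(ltW px) // lerXn2r ?nnegrE //.
  by rewrite exprn_ge0 // subr_ge0 ltW.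
have two_ge0 : (0 <= IZR 2)%R by apply/RleP/IZR_le.
apply/RleP; rewrite !RmultE !RinvE -mulrA.
by rewrite ler_wpM2l ?invr_ge0.
Qed.
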